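(* Let $P$ be a poset. (1) The map $\eta:P\to\Gamma(P)$, $\eta(x)=\mathord{\downarrow}x$, is Scott continuous. (2) The map $f:\sigma(P)\to\sigma(\Gamma(P))$ defined by $f(U)=\Diamond U=\{A\in\Gamma(P): A\cap U\neq\emptyset\}$ preserves arbitrary suprema. (3) Let $\eta^{-1}:\sigma(\Gamma(P))\to\sigma(P)$ be defined by $\eta^{-1}(\mathcal{U})=\{x\in P: \mathord{\downarrow}x\in\mathcal{U}\}$. Then $\eta^{-1}\circ f=1_{\sigma(P)}$ and $f\circ\eta^{-1}\leq 1_{\sigma(\Gamma(P))}$; consequently $(\eta^{-1},f)$ is an adjunction (with $\eta^{-1}$ the upper adjoint and $f$ the lower adjoint).
   Context: For a poset $P$ and $x\in P$, $\mathord{\downarrow}x=\{y\in P: y\le x\}$. A subset $A\subseteq P$ is Scott closed if it is a lower set and for every directed $D\subseteq A$ whose supremum $\bigvee D$ exists in $P$ one has $\bigvee D\in A$. The Scott topology $\sigma(P)$ consists of the complements of Scott closed sets; it is a complete lattice under inclusion. $\Gamma(P)$ is the complete lattice of all Scott closed subsets of $P$ (including $\emptyset$), ordered by inclusion, and $\sigma(\Gamma(P))$ is the lattice of Scott open subsets of $\Gamma(P)$, ordered by inclusion. A map between posets is Scott continuous if it is continuous for the Scott topologies. Maps between posets are ordered pointwise. A pair $(g,d)$ of monotone maps $g:S\to T$, $d:T\to S$ between posets is an adjunction if for all $s\in S,t\in T$: $t\le g(s)$ iff $d(t)\le s$; $g$ is then the upper and $d$ the lower adjoint. *)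

(* Defs.v *)
From HB Require Import structures.
From mathcomp Require Import all_boot all_order.
From mathcomp Require Import boolp classical_sets topology.

Set Implicit Arguments.
Unset Strict Implicit.
Unset Printing Implicit Defensive.

Import Order.TTheory.
Local Open Scope order_scope.
Local Open Scope classical_set_scope.

Section PosetNotions.
Context {d : Order.disp_t} {P : porderType d}.
Implicit Types A D : set P.

Definition lower_set A := forall x y, x <= y -> A y -> A x.

(* Directed sets are nonempty; in particular [set0] is Scott closed. *)
Definition directed D :=
  D !=set0 /\
  forall x y, D x -> D y -> exists2 z, D z & (x <= z) && (y <= z).

(* [supremums D s] says that the supremum of [D] exists and is [s]. *)
Definition scott_closed A :=
  lower_set A /\
  forall D s, directed D -> D `<=` A -> supremums D s -> A s.

Lemma scott_closedT : scott_closed setT.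
Proof. by []. Qed.

Lemma scott_closed0 : scott_closed set0.
Proof. by split=> // D s [[x Dx] _] /(_ x Dx). Qed.

Lemma scott_closedU A B :
  scott_closed A -> scott_closed B -> scott_closed (A `|` B).
Proof.
move=> [Al As] [Bl Bs]; split.
  by move=> x y xy [Ay|By]; [left; apply: Al Ay|right; apply: Bl By].
move=> D s Ddir DAB Ds.
have [DA|/existsNP[a /not_implyP[Da nAa]]] := pselect (D `<=` A).
  by left; apply: As DA Ds.
right; apply: (Bs (D `&` [set y | a <= y])).
- split; first by exists a; split=> //=.
  move=> x y [Dx ax] [Dy ay]; have [z Dz /andP[xz yz]] := Ddir.2 _ _ Dx Dy.
  by exists z; [split=> //=; apply: le_trans xz|apply/andP].
- by move=> y [/DAB[Ay|//]] ay; case: nAa; apply: Al Ay.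
- case: Ds => ubs lubs; split; first by move=> y [/ubs].
  move=> u ubu; apply: lubs => y Dy.
  have [z Dz /andP[az yz]] := Ddir.2 _ _ Da Dy.
  by apply: le_trans yz _; apply: ubu.
Qed.

Lemma scott_closed_bigcap (J : Type) (F : J -> set P) :
  (forall i, scott_closed (F i)) -> scott_closed (\bigcap_i F i).
Proof.
move=> Fcl; split.
  by move=> x y xy Fy i _; exact: ((Fcl i).1 _ _ xy (Fy i I)).
move=> D s Ddir DF Ds i _; apply: ((Fcl i).2 _ _ Ddir _ Ds).
by move=> x /DF; apply.
Qed.

Lemma scott_closed_down x : scott_closed [set y : P | y <= x].
Proof.
split=> [y z /= yz zx|D s _ Dx [_ lubs]]; first exact: le_trans zx.
exact: lubs.
Qed.

End PosetNotions.

(* The poset P equipped with its Scott topology. *)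
Definition scott d (P : porderType d) : Type := P.

HB.instance Definition _ d (P : porderType d) :=
  Order.POrder.copy (scott P) P.

Section ScottTopology.
Context d (P : porderType d).

Definition scott_open (U : set (scott P)) := scott_closed (~` U).

Lemma scott_openT : scott_open setT.
Proof. by rewrite /scott_open setCT; exact: scott_closed0. Qed.

Lemma scott_openI : setI_closed scott_open.
Proof. by move=> U V *; rewrite /scott_open setCI; exact: scott_closedU. Qed.

Lemma scott_open_bigcup (J : Type) (F : J -> set (scott P)) :
  (forall i, scott_open (F i)) -> scott_open (\bigcup_i F i).
Proof. by move=> *; rewrite /scott_open setC_bigcup; exact: scott_closed_bigcap. Qed.

HB.instance Definition _ := isOpenTopological.Build (scott P)
  scott_openT scott_openI scott_open_bigcup.

Lemma open_scottE (U : set (scott P)) : open U = scott_closed (~` U).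
Proof. by []. Qed.

End ScottTopology.

(* The lattice of open sets, ordered by inclusion (the order of [set T]). *)
Record opens (T : topologicalType) := Opens {
  opens_set :> set T;
  opens_subproof : `[< open opens_set >]
}.

HB.instance Definition _ (T : topologicalType) :=
  [isSub for @opens_set T].
HB.instance Definition _ (T : topologicalType) := [Choice of opens T by <:].
HB.instance Definition _ (T : topologicalType) :=
  [SubChoice_isSubPOrder of opens T by <: with set_display].

Definition mk_opens (T : topologicalType) (U : set T) (oU : open U) : opens T :=
  Opens (asboolT oU).

Definition preim_opens (S T : topologicalType) (f : S -> T)
    (cf : continuous f) (V : opens T) : opens S :=
  mk_opens ((continuousP f).1 cf (val V) (asboolW (valP V))).

Notation sigma P := (opens (scott P)).

(* The lattice of Scott closed sets, ordered by inclusion. *)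
Record Gamma d (P : porderType d) := MkGamma {
  Gamma_set :> set P;
  Gamma_subproof : `[< scott_closed Gamma_set >]
}.

HB.instance Definition _ d (P : porderType d) :=
  [isSub for @Gamma_set d P].
HB.instance Definition _ d (P : porderType d) := [Choice of Gamma P by <:].
HB.instance Definition _ d (P : porderType d) :=
  [SubChoice_isSubPOrder of Gamma P by <: with set_display].

Lemma opens_leE (T : topologicalType) (U V : opens T) :
  (U <= V) = (val U `<=` val V) :> Prop.
Proof. by rewrite -subsetEset -Order.le_val. Qed.

Lemma Gamma_leE d (P : porderType d) (A B : Gamma P) :
  (A <= B) = (val A `<=` val B) :> Prop.
Proof. by rewrite -subsetEset -Order.le_val. Qed.

(* Arbitrary suprema exist in [opens T]: they are unions. *)
Lemma opens_supremums (T : topologicalType) (F : set (opens T)) :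
  exists2 U : opens T, supremums F U & val U = \bigcup_(V in F) val V.
Proof.
have oF : open (\bigcup_(V in F) val V).
  by apply: bigcup_open => V _; apply: asboolW (valP V).
exists (mk_opens oF) => //; split=> [V FV|W ubW].
  by rewrite opens_leE => x Vx; exists V.
rewrite opens_leE => x [V FV Vx].
by have := ubW V FV; rewrite opens_leE; apply.
Qed.

Section EtaDiamond.
Context d (P : porderType d).

Definition eta (x : P) : Gamma P :=
  MkGamma (asboolT (scott_closed_down x)).

Definition diamond_set (U : set P) : set (scott (Gamma P)) :=
  [set A : Gamma P | val A `&` U !=set0].

Lemma diamond_open (U : set (scott P)) : open U -> open (diamond_set U).
Proof.
rewrite !open_scottE => cU; split=> [A B /= AB nB|].
  move=> [x [Ax Ux]]; apply: nB; exists x; split=> //.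
  by move: AB; rewrite Gamma_leE; apply.
move=> D S _ Dn [_ lubS] [x [Sx Ux]].
pose C : Gamma P := @MkGamma d P (~` U) (asboolT cU).
have : S <= C.
  apply: lubS => A /Dn nA; rewrite Gamma_leE => y Ay Uy.
  by apply: nA; exists y.
by rewrite Gamma_leE => /(_ x Sx).
Qed.

Definition diamond (U : sigma P) : sigma (Gamma P) :=
  mk_opens (diamond_open (asboolW (valP U))).

End EtaDiamond.

Definition preserves_sups d d' (S : porderType d) (T : porderType d')
    (f : S -> T) :=
  forall (F : set S) (s : S), supremums F s -> supremums (f @` F) (f s).

Definition scott_continuous d d' (S : porderType d) (T : porderType d')
    (f : S -> T) :=
  continuous (f : scott S -> scott T).

(* [g] is the upper adjoint and [f] the lower adjoint. *)
Definition adjunction d d' (S : porderType d) (T : porderType d')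
    (g : S -> T) (f : T -> S) :=
  [/\ {homo g : s s' / s <= s'}, {homo f : t t' / t <= t'} &
      forall s t, t <= g s <-> f t <= s].

(* The map of open-set lattices V |-> f^-1(V) exists because [f] is
   Scott continuous. *)
Definition sigma_preim d d' (S : porderType d) (T : porderType d')
    (f : S -> T) (cf : scott_continuous f) : sigma T -> sigma S :=
  preim_opens cf.

(* Main.v *)
Require Import Defs.
From mathcomp Require Import all_boot all_order.
From mathcomp Require Import boolp classical_sets topology.

Local Open Scope order_scope.

Import Order.TTheory.
Local Open Scope classical_set_scope.

(** Scott continuity of [eta] amounts to its being monotone and preserving directed
    suprema.  The second point is where Scott closedness is used: if [s] is
    the supremum of a directed set [D], a Scott closed set containing every
    [eta x] with [x] in [D] contains [D], hence [s], hence [eta s].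

    The other claims come from two facts about membership.  An open set [U]
    of [P] is an upper set, so the principal ideal of [x] meets [U] exactly
    when [x] is in [U]: pulling [diamond U] back along [eta] gives [U].  In
    the other direction, if [A] meets the pullback of [V] at [x], then
    [eta x] is in [V] and below [A], so that [A] is in the upper set [V].
    These are the unit and the counit of an adjunction between monotone maps,
    and preservation of suprema by [diamond] is the general fact that a lower
    adjoint preserves all the suprema that exist. *)

Section PosetMaps.
Context (d d' : Order.disp_t) (S : porderType d) (T : porderType d').

Lemma directed_image (f : S -> T) (D : set S) :
  {homo f : x y / x <= y} -> directed D -> directed (f @` D).
Proof.
move=> fmono [[x0 Dx0] Ddir]; split; first by exists (f x0), x0.
move=> _ _ [x Dx <-] [y Dy <-].
have [z Dz /andP[xz yz]] := Ddir _ _ Dx Dy.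
by exists (f z); [exists z | rewrite !fmono].
Qed.

(** The preimage of a Scott closed set is Scott closed, since the image of a
    directed set inside it is directed and has the expected supremum. *)
Lemma scott_continuous_directed_sups (f : S -> T) :
  {homo f : x y / x <= y} ->
  (forall (D : set S) s,
      directed D -> supremums D s -> supremums (f @` D) (f s)) ->
  scott_continuous f.
Proof.
move=> fmono fsup; apply/continuousP => V.
rewrite !open_scottE => -[Vlow Vsup]; split.
  by move=> x y /fmono fxy; apply: Vlow.
move=> D s Ddir DV Ds; apply: (Vsup (f @` D)).
- exact: directed_image.
- by move=> _ [x Dx <-]; apply: DV.
- exact: fsup.
Qed.

Lemma adjunction_unit_counit (g : S -> T) (f : T -> S) :
  {homo g : s s' / s <= s'} -> {homo f : t t' / t <= t'} ->
  (forall t, t <= g (f t)) -> (forall s, f (g s) <= s) ->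
  adjunction g f.
Proof.
move=> gmono fmono unit counit; split=> // s t; split=> [/fmono|/gmono].
  by move=> /le_trans; apply.
exact: le_trans.
Qed.

Lemma lower_adjoint_preserves_sups (g : S -> T) (f : T -> S) :
  adjunction g f -> preserves_sups f.
Proof.
move=> [_ fmono adj] F t [ubt lubt]; split.
  by move=> _ [u Fu <-]; apply/fmono/ubt.
move=> s ubs; apply/adj/lubt => u Fu.
by apply/adj/ubs; exists u.
Qed.

End PosetMaps.

Lemma scott_open_upper d (P : porderType d) (U : sigma P) (x y : P) :
  x <= y -> val U x -> val U y.
Proof.
move=> xy Ux; apply: contrapT => nUy.
by have [low _] := asboolW (valP U); apply: (low x y xy nUy).
Qed.

Lemma diamond_homo d (P : porderType d) :
  {homo @diamond d P : U V / U <= V}.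
Proof.
move=> U V; rewrite !opens_leE => UV A [x [Ax Ux]].
by exists x; split=> //; apply: UV.
Qed.

Lemma sigma_preim_homo d d' (S : porderType d) (T : porderType d')
    (f : S -> T) (cf : scott_continuous f) :
  {homo sigma_preim cf : V W / V <= W}.
Proof. by move=> V W; rewrite !opens_leE => VW x; apply: VW. Qed.

Section Eta.
Context d (P : porderType d).

(** Scott closed sets are lower sets; this is what turns comparisons with
    [eta x] into membership of [x] in the rest of the argument. *)
Lemma eta_leE (x : P) (A : Gamma P) : (eta x <= A) = val A x :> Prop.
Proof.
rewrite Gamma_leE; apply/propext; split=> [|Ax y]; first by apply=> /=.
by have [low _] := asboolW (valP A); move/low; apply.
Qed.

Lemma eta_homo : {homo @eta d P : x y / x <= y}.
Proof. by move=> x y xy; rewrite eta_leE. Qed.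

Lemma eta_scott_continuous : scott_continuous (@eta d P).
Proof.
apply: scott_continuous_directed_sups eta_homo _ => D s Ddir Ds; split.
  by move=> _ [x Dx <-]; apply/eta_homo/Ds.1.
move=> A ubA; rewrite eta_leE.
have [_ Asup] := asboolW (valP A).
apply: Asup Ddir _ Ds => x Dx.
have etaA : eta x <= A by apply: ubA; exists x.
by move: etaA; rewrite eta_leE.
Qed.

Variable eta_cont : scott_continuous (@eta d P).

Lemma sigma_preim_diamond (U : sigma P) :
  sigma_preim eta_cont (diamond U) = U.
Proof.
apply/val_inj/seteqP; split=> x /=; last by exists x; split=> /=.
by move=> [y [yx Uy]]; apply: scott_open_upper Uy.
Qed.

Lemma diamond_sigma_preim (V : sigma (Gamma P)) :
  diamond (sigma_preim eta_cont V) <= V.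
Proof.
rewrite opens_leE => A [x [Ax Vx]].
by apply: (@scott_open_upper _ (Gamma P) V (eta x)) => //; rewrite eta_leE.
Qed.

End Eta.

Theorem proposition3p10 (d : Order.disp_t) (P : porderType d) :
  exists eta_cont : scott_continuous (@eta d P),
    let f : sigma P -> sigma (Gamma P) := @diamond d P in
    let eta_inv : sigma (Gamma P) -> sigma P := sigma_preim eta_cont in
    [/\ preserves_sups f,
        eta_inv \o f = id,
        f \o eta_inv <= id &
        adjunction eta_inv f].
Proof.
exists (@eta_scott_continuous d P) => f eta_inv.
have adj : adjunction eta_inv f.
  apply: adjunction_unit_counit.
  - exact: sigma_preim_homo.
  - exact: diamond_homo.
  - by move=> U; rewrite /eta_inv /f sigma_preim_diamond.
  - exact: diamond_sigma_preim.
split=> //.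
- exact: lower_adjoint_preserves_sups adj.
- by apply/funext => U; apply: sigma_preim_diamond.
- by apply/lefP => V; apply: diamond_sigma_preim.
Qed.
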